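(* Let $V$ be a finite-dimensional real vector space with a positive definite scalar product $\langle\;,\;\rangle$, and let $\{\alpha_i\}_{i\in\Gamma}$ be a basis of $V$ such that $\langle\alpha_i,\alpha_j\rangle\le 0$ for all $i\ne j$. Then for every $x\in V$, $\mathfrak{L}(x)$ is the least element, with respect to the ordering $\le$, of the set $\{y\in V^+ \mid y\ge x\}$.
   Context: Let $\{\omega_i\}_{i\in\Gamma}$ be the basis of $V$ dual to $\{\alpha_i\}$ with respect to the scalar product, i.e. $\langle\alpha_i,\omega_j\rangle=\delta_{ij}$. Let $V^+\subset V$ be the closed convex cone generated by the $\omega_i$, $i\in\Gamma$; equivalently $V^+=\{y\in V: \langle\alpha_i,y\rangle\ge 0 \text{ for all } i\in\Gamma\}$. The Langlands retraction $\mathfrak{L}:V\to V^+$ is defined by letting $\mathfrak{L}(x)$ be the point of $V^+$ closest to $x$ (in the Euclidean metric given by $\langle\;,\;\rangle$); it exists and is unique because $V^+$ is closed and convex. Let $V^{pos}$ be the closed convex cone generated by the $\alpha_i$, $i\in\Gamma$. The partial ordering on $V$ (and on $V^+$) is: $x\le y$ if $y-x\in V^{pos}$. The least element of a set $S$ is an element $s\in S$ with $s\le y$ for all $y\in S$. *)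

(* Defs.v *)
From HB Require Import structures.
From mathcomp Require Import all_boot all_order all_algebra.
From mathcomp Require Import sesquilinear.
From mathcomp Require Import all_classical reals.

Set Implicit Arguments.
Unset Strict Implicit.
Unset Printing Implicit Defensive.

Import Order.TTheory GRing.Theory Num.Theory.

Local Open Scope classical_set_scope.
Local Open Scope ring_scope.

Definition cone_gen (R : realType) (V : vectType R) (Gamma : finType)
    (v : Gamma -> V) : set V :=
  [set x | exists2 c : Gamma -> R,
     forall i, 0 <= c i & x = \sum_i c i *: v i].

Section Langlands.
Context (R : realType) (V : vectType R).

(* [{dot V for idfun}]: with the trivial conjugation [idfun] on [R], these are
   exactly the symmetric positive definite bilinear forms on [V]. *)
Variable dot : {dot V for (idfun : R -> R)}.

Definition dist (x y : V) : R := Num.sqrt (dot (x - y) (x - y)).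

Variables (Gamma : finType) (alpha : Gamma -> V).

Definition is_dual (omega : Gamma -> V) : Prop :=
  forall i j, dot (alpha i) (omega j) = (i == j)%:R.

(* The default value is irrelevant: a basis [alpha] has exactly one dual
   family. *)
Definition dual_basis : Gamma -> V :=
  xget (fun=> 0) [set omega | is_dual omega].

Definition Vplus : set V := cone_gen dual_basis.

Definition Vpos : set V := cone_gen alpha.

Definition Vle (x y : V) : Prop := Vpos (y - x).

Definition is_least (S : set V) (s : V) : Prop :=
  S s /\ forall y, S y -> Vle s y.

Definition is_closest (S : set V) (x p : V) : Prop :=
  S p /\ forall y, S y -> dist x p <= dist x y.

(* The default value is irrelevant: [Vplus] is a nonempty closed convex subset
   of a Euclidean space, so the closest point exists and is unique. *)
Definition retraction (x : V) : V := xget 0 [set p | is_closest Vplus x p].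

End Langlands.

(* Main.v *)
Require Import Defs.
From HB Require Import structures.
From mathcomp Require Import all_boot all_order all_algebra.
From mathcomp Require Import sesquilinear.
From mathcomp Require Import all_classical reals.
From mathcomp Require Import lra.

Set Implicit Arguments.
Unset Strict Implicit.
Unset Printing Implicit Defensive.

Import Order.TTheory GRing.Theory Num.Theory.

Local Open Scope classical_set_scope.
Local Open Scope ring_scope.

(** The point p = L(x) is pinned down by a complementarity condition: p pairs
    nonnegatively with every alpha_i, and p - x is a nonnegative combination of
    those alpha_i that are orthogonal to p.

    Such a p is both the closest point and the least upper point.  For y in V^+
    it satisfies <x - p, y - p> <= 0,
    which makes p the unique closest point of V^+ ([complementary_closest]).
    And if y in V^+ lies above x, a negative coefficient of y - p in the basis
    alpha can only occur at an index i with <alpha_i, p> = 0, where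
    <alpha_i, y - p> >= 0; because the alpha_i are mutually obtuse, this forces
    all coefficients of y - p to be nonnegative ([obtuse_coef_ge0]), so that
    p <= y ([complementary_least]).

    A complementary point exists by a finite greedy argument
    ([exists_complementary]): among the sets J such that the projection of x
    orthogonal to {alpha_j | j in J} is obtained by adding a nonnegative
    combination of these alpha_j, a maximal one works, since an index violating
    <alpha_i, p> >= 0 could be added to J, again by obtuseness. *)

(** * Linear algebra in a Euclidean space with a basis *)

Section ObtuseBasis.
Context (R : realType) (V : vectType R).
Variable dot : {dot V for (idfun : R -> R)}.
Variables (Gamma : finType) (alpha : Gamma -> V).
Hypothesis alpha_basis : basis_of fullv (codom alpha).
Hypothesis alpha_obtuse :
  forall i j : Gamma, i != j -> dot (alpha i) (alpha j) <= 0.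

Let comb (c : Gamma -> R) : V := \sum_i c i *: alpha i.

(* Rewriting with the generic bilinearity lemmas leaves the underlying bilinear
   map in place of [dot]; these instances keep every term headed by [dot]. *)
Lemma dotDr u v w : dot u (v + w) = dot u v + dot u w.
Proof. exact: linearDr. Qed.

Lemma dotBr u v w : dot u (v - w) = dot u v - dot u w.
Proof. exact: linearBr. Qed.

Lemma dotBl u v w : dot (u - v) w = dot u w - dot v w.
Proof. exact: linearBl. Qed.

Lemma dotNl u v : dot (- u) v = - dot u v.
Proof. exact: linearNl. Qed.

Lemma dotZr a u v : dot u (a *: v) = a * dot u v.
Proof. exact: linearZr_LR. Qed.

Lemma dotC u v : dot u v = dot v u.
Proof. by rewrite hermC expr0 mul1r. Qed.

Lemma dotxx_ge0 u : 0 <= dot u u.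
Proof.
have [->|u0] := eqVneq u 0; first by rewrite linear0l.
exact/ltW/neq0_dnorm_gt0.
Qed.

Lemma dotxx_le0 u : dot u u <= 0 -> u = 0.
Proof. by apply: contraTeq => u0; rewrite -ltNge neq0_dnorm_gt0. Qed.

Lemma dot_combl c v : dot (comb c) v = \sum_i c i * dot (alpha i) v.
Proof.
by rewrite linear_sumlz; apply: eq_bigr => i _; rewrite linearZl_LR.
Qed.

Lemma combB c d : comb c - comb d = comb (fun i => c i - d i).
Proof.
by rewrite /comb -sumrB; apply: eq_bigr => i _; rewrite scalerBl.
Qed.

Lemma combD c d : comb c + comb d = comb (fun i => c i + d i).
Proof.
by rewrite /comb -big_split; apply: eq_bigr => i _; rewrite scalerDl.
Qed.

(** Bridges between the sequence [codom alpha], enumerated by ordinals, and the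
    family [alpha] indexed by [Gamma]. *)
Lemma codom_comb (k : 'I_#|Gamma| -> R) :
  \sum_i k i *: (codom_tuple alpha)`_i = comb (k \o enum_rank).
Proof.
rewrite /comb [RHS](reindex (@enum_val _ Gamma)); last first.
  by apply: onW_bij; exact: enum_val_bij.
by apply: eq_bigr => i _; rewrite /= enum_valK nth_codom.
Qed.

Lemma comb_eq0 c : comb c = 0 -> forall i, c i = 0.
Proof.
move=> c0 i.
have /andP[_ /(@freeP _ _ _ (codom_tuple alpha)) fr] := alpha_basis.
have := fr (c \o enum_val); rewrite codom_comb => /(_ _ (enum_rank i)) /=.
rewrite enum_rankK; apply; rewrite -[RHS]c0.
by apply: eq_bigr => j _; rewrite /= enum_rankK.
Qed.

Lemma combP v : exists c, v = comb c.
Proof.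
exists (coord (codom_tuple alpha) ^~ v \o enum_rank).
by rewrite -codom_comb -(coord_basis alpha_basis) ?memvf.
Qed.

Lemma dot_alpha_inj u v :
  (forall i, dot (alpha i) u = dot (alpha i) v) -> u = v.
Proof.
move=> uv; apply/eqP; rewrite -subr_eq0; apply/eqP/dotxx_le0.
have [c {1}->] := combP (u - v).
by rewrite dot_combl big1 // => i _; rewrite dotBr uv subrr mulr0.
Qed.

(** Each principal Gram matrix is invertible, because a combination of the
    [alpha j], [j \in J], orthogonal to all of them has zero norm.  The linear
    map used is this Gram matrix completed by the identity outside [J], so that
    bijectivity follows from injectivity on a single space. *)
Lemma gram_solve (J : {set Gamma}) (b : Gamma -> R) :
  exists2 c : Gamma -> R, forall i, i \notin J -> c i = 0 &
    forall i, i \in J -> dot (alpha i) (comb c) = b i.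
Proof.
pose T (d : {ffun Gamma -> R^o}) : {ffun Gamma -> R^o} :=
  [ffun i => if i \in J then
     dot (alpha i) (\sum_(k in J) (d k : R) *: alpha k) else d i].
have Tlin : linear T.
  move=> a u v; apply/ffunP => i; rewrite !ffunE; case: ifP => // _.
  rewrite -[RHS](linearPr dot (alpha i) a); congr (dot _ _).
  rewrite scaler_sumr -big_split; apply: eq_bigr => k _.
  by rewrite !ffunE scalerDl scalerA.
pose TL : {linear {ffun Gamma -> R^o} -> {ffun Gamma -> R^o}} :=
  HB.pack T (GRing.isLinear.Build _ _ _ _ T Tlin).
have extE (d : {ffun Gamma -> R^o}) : (forall i, i \notin J -> d i = 0) ->
    \sum_(k in J) (d k : R) *: alpha k = comb d.
  move=> d0; rewrite /comb [RHS](bigID [in J]) /= [X in _ + X]big1 ?addr0 //.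
  by move=> i /d0 ->; rewrite scale0r.
have ker0 : lker (linfun TL) == 0%VS.
  rewrite -subv0; apply/subvP => d; rewrite memv_ker memv0 lfunE /=.
  move=> /eqP/ffunP Td0.
  have d0 i : i \notin J -> d i = 0.
    by move=> /negbTE iJ; have := Td0 i; rewrite !ffunE iJ.
  apply/eqP/ffunP => i; rewrite ffunE; apply: (comb_eq0 (c := d)).
  apply: dotxx_le0; rewrite dot_combl big1 // => j _.
  have [jJ|/d0 ->] := boolP (j \in J); last by rewrite mul0r.
  by have := Td0 j; rewrite !ffunE jJ extE // => ->; rewrite mulr0.
pose d := ((linfun TL)^-1)%VF [ffun i => if i \in J then b i else 0].
have /ffunP Td : T d = [ffun i => if i \in J then b i else 0].
  have := lker0_lfunVK ker0 [ffun i => if i \in J then b i else 0].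
  by rewrite lfunE.
have d0 i : i \notin J -> d i = 0.
  by move=> /negbTE iJ; have := Td i; rewrite !ffunE iJ.
by exists d => // i iJ; have := Td i; rewrite !ffunE iJ extE.
Qed.

Lemma dual_basisP : is_dual dot alpha (dual_basis dot alpha).
Proof.
have ex j : exists w, forall i, dot (alpha i) w = (i == j)%:R.
  have [c _ cE] := gram_solve [set: Gamma] (fun i => (i == j)%:R).
  by exists (comb c) => i; apply: cE; rewrite inE.
have [omega omegaP] := choice ex.
rewrite /dual_basis; case: xgetP => [w _ //|/(_ omega)[]].
by move=> i j; apply: omegaP.
Qed.

Lemma VplusP y : Vplus dot alpha y <-> forall i, 0 <= dot (alpha i) y.
Proof.
have dotE c i : dot (alpha i) (\sum_j c j *: dual_basis dot alpha j) = c i.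
  rewrite linear_sumr (bigD1 i) //= dotZr dual_basisP eqxx /= mulr1.
  rewrite big1 ?addr0 // => j ji.
  by rewrite dotZr dual_basisP eq_sym (negbTE ji) /= mulr0.
split=> [[c c0 ->] i|y0]; first by rewrite dotE.
exists (fun i => dot (alpha i) y) => //.
by apply: dot_alpha_inj => i; rewrite dotE.
Qed.

(** * Obtuse families *)

(** Write comb c = p - n with the positive and negative parts of c.  These have
    disjoint supports, so <n, p> <= 0 by obtuseness, while the hypothesis says
    <n, comb c> >= 0; hence <n, n> <= 0. *)
Lemma obtuse_coef_ge0 (c : Gamma -> R) :
  (forall i, c i < 0 -> 0 <= dot (alpha i) (comb c)) -> forall i, 0 <= c i.
Proof.
move=> c0; pose p i := Num.max (c i) 0; pose n i := Num.max (- c i) 0.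
have n_ge0 i : 0 <= n i by rewrite le_max lexx orbT.
have p_ge0 i : 0 <= p i by rewrite le_max lexx orbT.
have np0 i : n i * p i = 0.
  rewrite /n /p; have [ci|ci] := leP 0 (c i).
    by rewrite (max_r (x := - c i)) ?oppr_le0 // mul0r.
  by rewrite mulr0.
have cE : comb c = comb p - comb n.
  rewrite combB; apply: eq_bigr => i _; congr (_ *: _).
  rewrite /n /p; have [ci|ci] := leP 0 (c i).
    by rewrite (max_r (x := - c i)) ?oppr_le0 // subr0.
  by rewrite (max_l (x := - c i)) ?oppr_ge0 ?ltW // sub0r opprK.
have nc : 0 <= dot (comb n) (comb c).
  rewrite dot_combl sumr_ge0 // => i _; have [ci|ci] := leP 0 (c i).
    by rewrite /n max_r ?oppr_le0 // mul0r.
  by rewrite mulr_ge0 // c0.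
have np : dot (comb n) (comb p) <= 0.
  rewrite dot_combl; apply: sumr_le0 => i _.
  rewrite dotC dot_combl mulr_sumr; apply: sumr_le0 => j _.
  have [->|ji] := eqVneq j i; first by rewrite mulrA np0 mul0r.
  by rewrite mulr_ge0_le0 // mulr_ge0_le0 // alpha_obtuse.
have n0 : comb n = 0.
  apply: dotxx_le0; move: nc.
  by rewrite cE dotBr subr_ge0 => /le_trans; apply.
move=> i; rewrite -oppr_le0; have := comb_eq0 n0 i.
by rewrite /n => <-; rewrite le_max lexx.
Qed.

(** * Complementary points *)

(** The Karush-Kuhn-Tucker conditions for projecting [x] onto [Vplus]; [c] is
    the family of multipliers. *)
Definition complementary (x p : V) : Prop :=
  (forall i, 0 <= dot (alpha i) p) /\
  exists c : Gamma -> R, [/\ forall i, 0 <= c i,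
    forall i, 0 < c i -> dot (alpha i) p = 0 & p = x + comb c].

(** [feasible J] says that the projection of [x] orthogonal to the [alpha j],
    [j \in J], lies above [x].  It holds for the empty set.  If [J] is feasible
    and the projection [p] has <alpha_i, p> < 0, the projection for [i |: J]
    differs from [p] by a combination whose pairings with its own generators
    are nonnegative, so its coefficients are nonnegative and [i |: J] is again
    feasible. *)
Lemma exists_complementary x : exists p, complementary x p.
Proof.
pose feasible (J : {set Gamma}) := `[< exists c : Gamma -> R,
  [/\ forall i, 0 <= c i, forall i, i \notin J -> c i = 0 &
      forall i, i \in J -> dot (alpha i) (x + comb c) = 0] >].
have : exists J, feasible J.
  exists finset.set0; apply/asboolP; exists (fun=> 0).
  by split=> // i; rewrite inE.
move=> /ex_maxset[J /maxsetP[/asboolP[c [c_ge0 cJ pJ]] Jmax]].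
exists (x + comb c); split; last first.
  exists c; split=> // i ci; apply: pJ.
  by apply: contraTT ci => /cJ ->; rewrite ltxx.
move=> i; rewrite leNgt; apply/negP => pi.
have iJ : i \notin J by apply: contraTN pi => /pJ ->; rewrite ltxx.
have [d dJ dE] := gram_solve (i |: J)
  (fun j => - dot (alpha j) (x + comb c)).
have d_ge0 : forall j, 0 <= d j.
  apply: obtuse_coef_ge0 => j dj.
  have jJ : j \in i |: J by apply: contraTT dj => /dJ ->; rewrite ltxx.
  rewrite dE // oppr_ge0; move: jJ; rewrite in_setU1.
  by move=> /predU1P[->|/pJ ->] //; apply: ltW.
suff /Jmax JE : feasible (i |: J).
  by move: iJ; rewrite -JE ?finset.subsetUr // setU11.
apply/asboolP; exists (fun j => c j + d j); split=> [j|j jJ|j jJ].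
- exact: addr_ge0.
- rewrite dJ // cJ ?addr0 //; apply: contra jJ => jJ.
  by rewrite in_setU1 jJ orbT.
- by rewrite -combD addrA dotDr dE // subrr.
Qed.

(** Expanding |x - y|^2 around [p] leaves |x - p|^2, |y - p|^2 and the cross
    term 2 <x - p, p - y>, which is nonnegative by complementarity. *)
Lemma complementary_dist x p y : complementary x p -> Vplus dot alpha y ->
  dot (x - p) (x - p) + dot (y - p) (y - p) <= dot (x - y) (x - y).
Proof.
move=> [p_ge0 [c [c_ge0 cp pE]]] /VplusP y_ge0.
have cross : 0 <= - dot (x - p) (y - p).
  rewrite -dotNl opprB.
  have -> : p - x = comb c by rewrite pE addrC addKr.
  rewrite dot_combl sumr_ge0 // => i _; have := c_ge0 i.
  rewrite le_eqVlt => /predU1P[<-|ci]; first by rewrite mul0r.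
  by rewrite mulr_ge0 // dotBr cp // subr0.
have -> : x - y = (x - p) - (y - p) by rewrite opprB addrA subrK.
move: (x - p) (y - p) cross => u v; rewrite oppr_ge0 => uv_le0.
by rewrite dotBr !dotBl (dotC v u); lra.
Qed.

Lemma complementary_closest x p : complementary x p ->
  retraction dot alpha x = p.
Proof.
move=> px; have Vp : Vplus dot alpha p by apply/VplusP; case: px.
apply: xget_unique => [|q [Vq qmin]].
  split=> // y Vy; apply: ler_wsqrtr.
  apply: le_trans (complementary_dist px Vy).
  by rewrite lerDl dotxx_ge0.
have := qmin p Vp; rewrite /dist ler_sqrt ?dotxx_ge0 // => qp.
have := le_trans (complementary_dist px Vq) qp.
by rewrite gerDl => /dotxx_le0/eqP; rewrite subr_eq0 => /eqP.
Qed.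

Lemma complementary_least x p : complementary x p ->
  is_least alpha [set y | Vplus dot alpha y /\ Vle alpha x y] p.
Proof.
move=> [p_ge0 [c [c_ge0 cp pE]]]; split.
  split; first exact/VplusP.
  by exists c => //; rewrite pE addrC addKr.
move=> y [/VplusP y_ge0 [d d_ge0 yx]].
have ypE : y - p = comb (fun i => d i - c i).
  by rewrite -combB pE opprD addrA yx.
exists (fun i => d i - c i) => //.
apply: obtuse_coef_ge0 => i dc.
rewrite -ypE dotBr cp ?subr0 //.
by apply: le_lt_trans (d_ge0 i) _; rewrite -subr_lt0.
Qed.

End ObtuseBasis.

Theorem corollary3p2 (R : realType) (V : vectType R)
    (dot : {dot V for (idfun : R -> R)})
    (Gamma : finType) (alpha : Gamma -> V)
    (alpha_basis : basis_of fullv (codom alpha))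
    (alpha_obtuse : forall i j : Gamma, i != j -> dot (alpha i) (alpha j) <= 0)
    (x : V) :
  is_least alpha [set y | Vplus dot alpha y /\ Vle alpha x y]
    (retraction dot alpha x).
Proof.
have [p px] := exists_complementary alpha_basis alpha_obtuse x.
rewrite (complementary_closest alpha_basis px).
exact: complementary_least.
Qed.
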